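(* Let $p$ be an odd prime, $C$ a cyclic code of length $p^r$ over a finite field, and $P$ a Sylow $p$-subgroup of $Per(C)$ which contains $T$. Then the set $H(P)=\{\sigma\in S_{p^r} : \sigma^{-1}T\sigma\in P\}$ satisfies: 1. $AG(p^r)=N_{S_{p^r}}(\langle T\rangle)\subset H(P)$; 2. $N_{S_{p^r}}(P)\subset H(P)$.
   Context: Coordinates of a code of length $n$ are indexed by $\mathbb{Z}/n\mathbb{Z}$. For a permutation $\sigma$ of the coordinates, $\sigma(C)=\{(x_{\sigma^{-1}(i)})_i : (x_i)_i\in C\}$, and $Per(C)=\{\sigma\in S_n:\sigma(C)=C\}$. The code $C$ is cyclic if it is linear and $T\in Per(C)$, where $T:i\mapsto i+1\bmod n$. $AG(n)=\{\tau_{a,b} : \gcd(a,n)=1,\ b\in\mathbb{Z}/n\mathbb{Z}\}$ where $\tau_{a,b}:x\mapsto ax+b \bmod n$. $N_G(K)$ is the normalizer of $K$ in $G$. *)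

(* Defs.v *)
From mathcomp Require Import all_boot all_order all_algebra all_fingroup all_solvable.

Set Implicit Arguments.
Unset Strict Implicit.
Unset Printing Implicit Defensive.

Import GRing.Theory.
Local Open Scope group_scope.

(* The coordinates Z/nZ are represented by their residues in 'I_n, so that
   every length n is covered, including n = 1. *)

Definition shift (n : nat) : 'S_n := perm (@ordS_inj n).

Lemma affine_map_subproof (n a b : nat) (x : 'I_n) : ((a * x + b) %% n < n)%N.
Proof. by rewrite ltn_pmod // (leq_ltn_trans (leq0n x)). Qed.

Definition affine_map (n a b : nat) (x : 'I_n) : 'I_n :=
  Ordinal (affine_map_subproof a b x).

(* The residues a, b < n suffice, since affine_map n a b and coprime a n
   depend only on a and b modulo n. *)
Definition AG (n : nat) : {set 'S_n} :=
  [set s : 'S_n | [exists a : 'I_n, exists b : 'I_n,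
     coprime a n && [forall x : 'I_n, s x == affine_map a b x]]].

Section Codes.

Variables (F : finFieldType) (n : nat).
Implicit Types (s : 'S_n) (C : {set 'rV[F]_n}).

(* The i-th entry of col_perm s^-1 x is x_(s^-1 i). *)
Definition perm_code s C : {set 'rV[F]_n} := [set col_perm s^-1 x | x in C].

Definition Per C : {set 'S_n} := [set s : 'S_n | perm_code s C == C].

Lemma Per_group_set C : group_set (Per C).
Proof.
have pc1 : perm_code 1 C = C.
  by rewrite /perm_code invg1 (eq_imset (g := id)) ?imset_id // => x;
    rewrite col_perm1.
have pcM s t D : perm_code (s * t) D = perm_code t (perm_code s D).
  by rewrite /perm_code -imset_comp; apply: eq_imset => x /=;
    rewrite invMg col_permM.
apply/group_setP; split=> [|s t]; first by rewrite inE pc1.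
by rewrite !inE => /eqP Cs /eqP Ct; rewrite pcM Cs Ct.
Qed.

Canonical Per_group C := Group (Per_group_set C).

Definition linear_code C : Prop := GRing.submod_closed C.

Definition cyclic_code C : Prop := linear_code C /\ shift n \in Per C.

End Codes.

(* The product of permutations is (s * t) x = t (s x), hence s * shift n * s^-1
   below is the composite written s^-1 T s for right-to-left composition. *)
Definition Hset (n : nat) (P : {set 'S_n}) : {set 'S_n} :=
  [set s : 'S_n | s * shift n * s^-1 \in P].

(* Main.v *)
(* A permutation s normalizes <T> iff it conjugates T to a power T^a, that is,
   iff s (x + 1) = s x + a for all x, so that s x = a x + s 0; surjectivity of s
   then makes a invertible mod n.  Both inclusions in H(P) hold because s T s^-1
   lies in P as soon as s normalizes P or a subgroup of P that contains T. *)

Require Import Defs.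
From mathcomp Require Import all_boot all_order all_algebra all_fingroup all_solvable.

Local Open Scope group_scope.

Lemma shiftXE (n k : nat) (x : 'I_n) :
  (shift n ^+ k) x = (x + k) %% n :> nat.
Proof.
elim: k => [|k IHk]; first by rewrite expg0 perm1 addn0 modn_small.
by rewrite expgSr permM permE /= IHk -addn1 modnDml addn1 addnS.
Qed.

Lemma AG_sub_norm_shift (n : nat) : AG n \subset 'N(<[shift n]>).
Proof.
apply/subsetP=> s; rewrite inE => /existsP[a /existsP[b /andP[_ /forallP sE]]].
have{}sE x : s x = (a * x + b) %% n :> nat by rewrite (eqP (sE x)).
have Ts : shift n ^ s = shift n ^+ a.
  (* Every point is [s x] for some [x], and there [shift n ^ s] takes the value [s (x + 1)]. *)
  apply/permP=> y; rewrite -(permKV s y); set x := _ y.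
  rewrite permJ; apply: val_inj => /=.
  rewrite shiftXE !sE permE /= modnDml -addn1 -modnDml modnMmr modnDml.
  by rewrite mulnDr muln1 addnAC.
by rewrite inE -cycleJ cycle_subG Ts mem_cycle.
Qed.

(** For [n = 0] this fails: [AG 0] is empty since ['I_0] is, yet the normalizer contains 1. *)
Lemma norm_shift_sub_AG (n : nat) : 0 < n -> 'N(<[shift n]>) \subset AG n.
Proof.
move=> n_gt0; apply/subsetP=> s nTs.
have /cycleP[a Ts] : shift n ^ s \in <[shift n]> by rewrite memJ_norm ?cycle_id.
pose o : 'I_n := Ordinal n_gt0.
have sE (x : 'I_n) : s x = (a * x + s o) %% n :> nat.
  (* Writing [x] as [T^x 0] gives [s x = (T^s)^x (s 0) = T^(a x) (s 0)]. *)
  have xE : x = (shift n ^+ x) o.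
    by apply: val_inj; rewrite /= shiftXE add0n modn_small.
  by rewrite {1}xE -permJ conjXg Ts -expgM shiftXE addnC.
(* The preimage of [s 0 + 1] is an inverse of [a] modulo [n]. *)
have [x sx] : exists x, s x = shift n (s o).
  by exists (s^-1 (shift n (s o))); rewrite permKV.
have ax1 : a * x = 1 %[mod n].
  by apply/eqP; rewrite -(eqn_modDr (s o)) -sE sx permE /= add1n.
have co_a : coprime a n.
  have : coprime (a * x) n by rewrite -coprime_modl ax1 coprime_modl coprime1n.
  by rewrite coprimeMl => /andP[].
rewrite inE; apply/existsP; exists (Ordinal (ltn_pmod a n_gt0)).
apply/existsP; exists (s o); rewrite /= coprime_modl co_a.
apply/forallP=> y; apply/eqP/val_inj => /=.
by rewrite sE -[RHS]modnDml modnMml modnDml.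
Qed.

Theorem proposition12 (p r : nat) (F : finFieldType)
    (C : {set 'rV[F]_(p ^ r)%N}) (P : {group 'S_(p ^ r)%N}) :
  prime p -> odd p ->
  cyclic_code C ->
  P \in 'Syl_p(Per C) ->
  shift (p ^ r)%N \in P ->
  (AG (p ^ r)%N = 'N(<[shift (p ^ r)%N]>) /\
   'N(<[shift (p ^ r)%N]>) \subset Hset P) /\
  'N(P) \subset Hset P.
Proof.
move=> p_pr _ _ _ PT.
(* The conjugating element is [s^-1], which lies in a normalizer exactly when [s] does. *)
have HsetE s : (s \in Hset P) = (shift (p ^ r) ^ s^-1 \in P).
  by rewrite inE conjgE invgK mulgA.
split; last by apply/subsetP=> s nPs; rewrite HsetE memJ_norm ?groupV.
split.
  apply/eqP; rewrite eqEsubset AG_sub_norm_shift norm_shift_sub_AG //.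
  by rewrite expn_gt0 prime_gt0.
apply/subsetP=> s nTs; rewrite HsetE.
have /subsetP-> // : <[shift (p ^ r)]> \subset P by rewrite cycle_subG.
by rewrite memJ_norm ?groupV ?cycle_id.
Qed.
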